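(* The order type of the well-ordered set $\mathcal{F}$ of fusible numbers (ordered as a subset of $\mathbb{R}$) is at least $\varepsilon_0$.
   Context: The fuse operation is the partial binary operation on real numbers $a\sim b=(a+b+1)/2$, applicable only when $|a-b|<1$. A fusible number is a real number obtainable from $0$ by finitely many (valid) applications of the fuse operation; i.e. the set $\mathcal{F}$ of fusible numbers is the smallest subset of $\mathbb{R}$ such that $0\in\mathcal{F}$ and, whenever $a,b\in\mathcal{F}$ and $|a-b|<1$, also $(a+b+1)/2\in\mathcal{F}$. The set $\mathcal{F}$ is well-ordered by the usual order of $\mathbb{R}$. The ordinal $\varepsilon_0$ is $\sup\{\omega,\omega^\omega,\omega^{\omega^\omega},\dots\}$. *)

(* Defs.v *)
From Stdlib Require Import Reals Lra Classical ProofIrrelevance Wellfounded.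

Open Scope R_scope.

(** * Fusible numbers *)

Definition fuse (a b : R) : R := (a + b + 1) / 2.

Inductive fusible : R -> Prop :=
| fusible_zero : fusible 0
| fusible_fuse : forall a b : R,
    fusible a -> fusible b -> Rabs (a - b) < 1 -> fusible (fuse a b).

(** * Ordinals *)

(** [mk_ord J f] is the least ordinal strictly above all the [f i].  Distinct
    terms may denote the same ordinal: equality of ordinals is [ole] in both
    directions. *)
Inductive Ord : Type :=
| mk_ord : forall J : Type, (J -> Ord) -> Ord.

Definition index (a : Ord) : Type := match a with mk_ord J _ => J end.

Definition elt (a : Ord) : index a -> Ord :=
  match a return index a -> Ord with mk_ord _ f => f end.

(** [a <= b] iff every [f i] is strictly below [b], and [x < b] iff
    [x <= g j] for some [j]. *)
Fixpoint ole (a b : Ord) {struct a} : Prop :=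
  match a, b with
  | mk_ord J f, mk_ord K g => forall i : J, exists j : K, ole (f i) (g j)
  end.

Definition ozero : Ord := mk_ord Empty_set (fun e => match e with end).

Definition osucc (a : Ord) : Ord := mk_ord unit (fun _ => a).

(** Least upper bound: as sets of smaller ordinals, the union of the [f i]. *)
Definition osup (J : Type) (f : J -> Ord) : Ord :=
  mk_ord {i : J & index (f i)} (fun p => elt (f (projT1 p)) (projT2 p)).

Definition omax (a b : Ord) : Ord :=
  osup bool (fun t => if t then a else b).

(** The operations below recurse on the right argument and treat its zero,
    successor and limit cases at once.  It is enough to range over the [f i]
    instead of over all ordinals below [mk_ord J f], since every such ordinal
    is below some [osucc (f i)] and the operations are monotone. *)

(** a + b = max (a, sup_{c < b} ((a + c) + 1)). *)
Fixpoint oadd (a b : Ord) {struct b} : Ord :=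
  match b with
  | mk_ord J f => omax a (osup J (fun i => osucc (oadd a (f i))))
  end.

(** a * b = sup_{c < b} (a * c + a). *)
Fixpoint omul (a b : Ord) {struct b} : Ord :=
  match b with
  | mk_ord J f => osup J (fun i => oadd (omul a (f i)) a)
  end.

Fixpoint ofnat (n : nat) : Ord :=
  match n with
  | O => ozero
  | S m => osucc (ofnat m)
  end.

Definition omega : Ord := osup nat ofnat.

(** omega^b = max (1, sup_{c < b} (omega^c * omega)). *)
Fixpoint omega_pow (b : Ord) : Ord :=
  match b with
  | mk_ord J f =>
      omax (osucc ozero) (osup J (fun i => omul (omega_pow (f i)) omega))
  end.

Fixpoint omega_tower (n : nat) : Ord :=
  match n with
  | O => omega
  | S m => omega_pow (omega_tower m)
  end.

Definition epsilon0 : Ord := osup nat omega_tower.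

(** * Well-ordered sets and order types *)

Record WellOrder : Type := {
  carrier : Type;
  wlt : carrier -> carrier -> Prop;
  wlt_trans : forall x y z, wlt x y -> wlt y z -> wlt x z;
  wlt_total : forall x y, wlt x y \/ x = y \/ wlt y x;
  wlt_wf : well_founded wlt
}.

(** The order type of the initial segment below [x]. *)
Definition rank (W : WellOrder) : carrier W -> Ord :=
  Fix (wlt_wf W) (fun _ => Ord)
    (fun x rec =>
       mk_ord {y : carrier W | wlt W y x}
         (fun y => rec (proj1_sig y) (proj2_sig y))).

Definition order_type (W : WellOrder) : Ord := mk_ord (carrier W) (rank W).

(** * The fusible numbers are well-ordered *)

Definition has_min (S : R -> Prop) : Prop :=
  exists m, S m /\ forall x, S x -> m <= x.

Definition well_ordered (P : R -> Prop) : Prop :=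
  forall S : R -> Prop,
    (forall x, S x -> P x) -> (exists x, S x) -> has_min S.

Lemma well_ordered_pair_sum (P : R -> Prop) (S : R -> R -> Prop) :
  well_ordered P ->
  (forall a b, S a b -> P a /\ P b) ->
  (exists a b, S a b) ->
  exists a b, S a b /\ forall c d, S c d -> a + b <= c + d.
Proof.
intros HP HS Hne.
apply NNPP; intro Hno.
assert (Hdec : forall a b, S a b -> exists c d, S c d /\ c + d < a + b).
{ intros a b Hab. apply NNPP; intro H. apply Hno. exists a, b. split; trivial.
  intros c d Hcd. apply Rnot_lt_le; intro Hlt. apply H. now exists c, d. }
set (G a b := S a b /\ forall c d, S c d -> c + d <= a + b -> a <= c).
assert (HG : forall a b, S a b -> exists c d, G c d /\ c + d <= a + b).
{ intros a b Hab.
  destruct (HP (fun x => exists y, S x y /\ x + y <= a + b))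
    as [m [[y [Hmy Hle]] Hmin]].
  - intros x [y [Hxy _]]. now apply (HS x y).
  - exists a, b. split; trivial. lra.
  - exists m, y. split; trivial. split; trivial.
    intros c d Hcd Hle'. apply Hmin. exists d. split; trivial. lra. }
destruct (HP (fun y => exists x, G x y)) as [m [[x Hxm] Hmin]].
- intros y [x [Hxy _]]. now apply (HS x y).
- destruct Hne as [a [b Hab]]. destruct (HG a b Hab) as [c [d [Hcd _]]].
  now exists d, c.
- destruct (Hdec x m (proj1 Hxm)) as [a [b [Hab Hlt]]].
  destruct (HG a b Hab) as [c [d [Hcd Hle]]].
  assert (x <= c) by (apply (proj2 Hxm c d); [apply Hcd | lra]).
  assert (m <= d) by (apply Hmin; now exists c).
  lra.
Qed.

Lemma fusible_ge0 (x : R) : fusible x -> 0 <= x.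
Proof. induction 1; unfold fuse; lra. Qed.

Lemma fusible_inv (z : R) :
  fusible z -> 0 < z ->
  exists a b, fusible a /\ fusible b /\ a <= b /\ b < a + 1 /\ z = fuse a b.
Proof.
intros [|a b Ha Hb Hab] Hz; [lra|].
apply Rabs_def2 in Hab.
destruct (Rle_or_lt a b).
- exists a, b. repeat split; trivial. lra.
- exists b, a. unfold fuse. repeat split; trivial; lra.
Qed.

Lemma fusible_well_ordered : well_ordered fusible.
Proof.
set (Fb r := fun x => fusible x /\ x < r).
set (E := fun r => well_ordered (Fb r)).
assert (HE0 : E 0).
{ intros S HS [x Hx]. destruct (HS x Hx) as [H1 H2].
  apply fusible_ge0 in H1. lra. }
assert (Hcut : forall (S : R -> Prop) s r, (forall x, S x -> fusible x) ->
          S s -> s < r -> E r -> has_min S).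
{ intros S s r HS Hs Hsr Hr.
  destruct (Hr (fun x => S x /\ x < r)) as [m [[Hm Hmr] Hmin]].
  - intros x [Hx Hxr]. split; auto.
  - now exists s.
  - exists m. split; trivial. intros x Hx.
    destruct (Rlt_or_le x r); [now apply Hmin | lra]. }
destruct (classic (bound E)) as [Hb | Hb].
2:{ intros S HS [s Hs].
    destruct (classic (exists r, E r /\ s < r)) as [[r [Hr Hsr]] | Hn].
    - now apply (Hcut S s r).
    - exfalso. apply Hb. exists s. intros r Hr. apply Rnot_lt_le.
      intro. apply Hn. now exists r. }
exfalso.
destruct (completeness E Hb (ex_intro _ 0 HE0)) as [l [Hub Hlub]].
assert (HI0 : 0 <= l) by now apply Hub.
assert (HEI : E l).
{ intros S HS [s Hs].
  destruct (classic (exists r, E r /\ s < r)) as [[r [Hr Hsr]] | Hn].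
  - apply (Hcut S s r); trivial. intros x Hx. apply (HS x Hx).
  - exfalso. destruct (HS s Hs) as [_ HsI].
    assert (l <= s); [|lra]. apply Hlub. intros r Hr. apply Rnot_lt_le.
    intro. apply Hn. now exists r. }
assert (Hdense : forall d, 0 < d -> exists z, fusible z /\ l < z < l + d).
{ intros d Hd. apply NNPP; intro Hn.
  assert (HEd : E (l + d)).
  { intros S HS [s Hs].
    assert (HleI : forall x, S x -> x <= l).
    { intros x Hx. destruct (HS x Hx). apply Rnot_lt_le. intro.
      apply Hn. now exists x. }
    destruct (classic (exists x, S x /\ x < l)) as [[x [Hx HxI]] | Hn'].
    - apply (Hcut S x l); trivial. intros y Hy. apply (HS y Hy).
    - assert (HgeI : forall x, S x -> l <= x).
      { intros x Hx. apply Rnot_lt_le. intro. apply Hn'. now exists x. }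
      exists s. split; trivial. intros x Hx.
      specialize (HleI s Hs). specialize (HgeI x Hx). lra. }
  apply Hub in HEd. lra. }
set (Z e a b := fusible a /\ fusible b /\ a <= b /\ b < a + 1
                /\ l < fuse a b < l + e).
assert (HZ : forall e d, 0 < e -> 0 < d ->
          exists a b, Z e a b /\ fuse a b < l + d).
{ intros e d He Hd. destruct (Hdense (Rmin e d)) as [z [Hz [Hz1 Hz2]]].
  - now apply Rmin_glb_lt.
  - destruct (fusible_inv z Hz) as [a [b [Ha [Hb' [Hle [Hlt Heq]]]]]]; [lra|].
    pose proof (Rmin_l e d). pose proof (Rmin_r e d).
    exists a, b. unfold Z. rewrite <- Heq. repeat split; trivial; lra. }
destruct (HEI (fun a => exists b, Z (1/2) a b)) as [a0 [[b0 H0] Hmin]].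
{ intros a [b [Ha [_ [Hle [_ Hz]]]]]. split; trivial. unfold fuse in Hz. lra. }
{ destruct (HZ (1/2) (1/2)) as [a [b [H _]]]; try lra. now exists a, b. }
assert (Ha0 : l - 1 < a0).
{ destruct H0 as [_ [_ [_ [H1 H2]]]]. unfold fuse in H2. lra. }
set (e := Rmin (1/2) ((a0 + 1 - l) / 2)).
assert (He : 0 < e) by (apply Rmin_glb_lt; lra).
assert (He1 : e <= 1/2) by apply Rmin_l.
assert (He2 : e <= (a0 + 1 - l) / 2) by apply Rmin_r.
destruct (well_ordered_pair_sum (Fb l) (Z e) HEI) as [a [b [Hab Hs]]].
- intros a b [Ha [Hb' [Hle [Hlt Hz]]]].
  assert (a0 <= a).
  { apply Hmin. exists b. repeat split; trivial; lra. }
  unfold fuse in Hz. repeat split; trivial; lra.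
- destruct (HZ e e) as [a [b [H _]]]; trivial. now exists a, b.
- assert (Hpos : 0 < fuse a b - l) by (destruct Hab as [_ [_ [_ [_ Hz]]]]; lra).
  destruct (HZ e (fuse a b - l) He Hpos) as [c [d [Hcd Hlt]]].
  specialize (Hs c d Hcd). unfold fuse in Hlt. lra.
Qed.

Definition Fusible : Type := {x : R | fusible x}.

Definition fusible_lt (x y : Fusible) : Prop := proj1_sig x < proj1_sig y.

Lemma fusible_lt_trans (x y z : Fusible) :
  fusible_lt x y -> fusible_lt y z -> fusible_lt x z.
Proof. apply Rlt_trans. Qed.

Lemma fusible_lt_total (x y : Fusible) :
  fusible_lt x y \/ x = y \/ fusible_lt y x.
Proof.
destruct x as [x Hx], y as [y Hy]; unfold fusible_lt; simpl.
destruct (Rtotal_order x y) as [H | [H | H]]; auto.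
subst y. right; left. f_equal. apply proof_irrelevance.
Qed.

Lemma fusible_lt_wf : well_founded fusible_lt.
Proof.
intro x. apply NNPP; intro Hx.
destruct (fusible_well_ordered
            (fun r => exists y : Fusible, proj1_sig y = r /\ ~ Acc fusible_lt y))
  as [m [[y [Hy Hacc]] Hmin]].
- intros r [y [<- _]]. apply proj2_sig.
- now exists (proj1_sig x), x.
- apply Hacc. constructor. intros z Hz. apply NNPP; intro Hnz.
  unfold fusible_lt in Hz. rewrite Hy in Hz.
  assert (m <= proj1_sig z) by (apply Hmin; now exists z).
  lra.
Qed.

Definition fusible_order : WellOrder :=
  {| carrier := Fusible;
     wlt := fusible_lt;
     wlt_trans := fusible_lt_trans;
     wlt_total := fusible_lt_total;
     wlt_wf := fusible_lt_wf |}.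

(* Main.v *)
Require Import Defs.
From Stdlib Require Import Reals Lra FunctionalExtensionality.

(** The key claim: if [x] is fusible and the fusible numbers below [x] have
    order type at least [alpha], then those in [[u, x + 1)] have order type at
    least [omega^alpha], for every [u < x + 1].  By induction on [alpha]: a
    [beta < alpha] is realised below some fusible [w < x], so copies of
    [omega^beta] accumulate at [z = w + 1].  Translation by 1/2 (fusing a number
    with itself) moves [z] close to [x + 1], and fusing with [x] then halves the
    distance to [x + 1].  Hence there are infinitely many consecutive copies of
    [omega^beta] just below [x + 1], which make up [omega^beta * omega].
    Starting from [omega] below 1, the claim puts the [n]-th tower below
    [n + 1]. *)

(** [fits a u v]: the fusible numbers in [[u, v)] have order type at least
    [a]. *)
Fixpoint fits (a : Ord) (u v : R) {struct a} : Prop :=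
  match a with
  | mk_ord J f =>
      forall i : J, exists w, fusible w /\ u <= w < v /\ fits (f i) u w
  end.

Lemma fits_weaken (a : Ord) (u v u' v' : R) :
  u' <= u -> v <= v' -> fits a u v -> fits a u' v'.
Proof.
revert v v'; induction a as [J f IH]; simpl; intros v v' Hu Hv H i.
destruct (H i) as [w [Hw [Huw Hf]]].
exists w; repeat split; trivial; try lra.
now apply (IH i w); [| lra |].
Qed.

Lemma fits_elt (a : Ord) (u v : R) (i : index a) :
  fits a u v -> exists w, fusible w /\ u <= w < v /\ fits (elt a i) u w.
Proof. destruct a as [J f]; intro H; exact (H i). Qed.

Lemma fits_osup (J : Type) (f : J -> Ord) (u v : R) :
  (forall i, fits (f i) u v) -> fits (osup J f) u v.
Proof. intros H [i k]; exact (fits_elt (f i) u v k (H i)). Qed.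

Lemma fits_omax (a b : Ord) (u v : R) :
  fits a u v -> fits b u v -> fits (omax a b) u v.
Proof. intros Ha Hb; apply fits_osup; now intros []. Qed.

Lemma fits_oadd (a b : Ord) (u v w : R) :
  u <= v -> v <= w -> fits a u v -> fits b v w -> fits (oadd a b) u w.
Proof.
revert w; induction b as [J f IH]; intros w Huv Hvw Ha Hb.
apply fits_omax; [now apply (fits_weaken a u v); [lra | |] |].
apply fits_osup; intros i [].
destruct (Hb i) as [p [Hp [Hvp Hf]]].
exists p; repeat split; trivial; try lra.
apply IH; trivial; lra.
Qed.

Lemma fits_omul_ofnat (a : Ord) (u v : R) (n : nat) :
  u < v ->
  (forall t, t < v -> exists t', t < t' < v /\ fits a t t') ->
  exists t, u <= t < v /\ fits (omul a (ofnat n)) u t.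
Proof.
intros Huv H; induction n as [|n [t [Ht Hf]]]; simpl.
- exists u; split; [lra | intros [[] _]].
- destruct (H t (proj2 Ht)) as [t' [Ht' Ha]].
  exists t'; split; [lra |].
  apply fits_osup; intros _.
  apply (fits_oadd _ _ _ t); trivial; lra.
Qed.

Lemma fits_omul_omega (a : Ord) (u v : R) :
  u < v ->
  (forall t, t < v -> exists t', t < t' < v /\ fits a t t') ->
  fits (omul a omega) u v.
Proof.
(* An index of [omega] pairs some [m] with an index of [ofnat m]: none for 0, and for [S n] the one
   denoting [ofnat n]. So [n] copies of [a] and one more must fit. *)
intros Huv H; apply fits_osup; intros [[|n] k]; destruct k; simpl.
destruct (fits_omul_ofnat a u v n Huv H) as [t [Ht Hf]].
destruct (H t (proj2 Ht)) as [t' [Ht' Ha]].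
apply (fits_oadd _ _ _ t); trivial; try lra.
apply (fits_weaken a t t'); trivial; lra.
Qed.

(** Fusing with [c] is increasing, and it is allowed on all of [[u, v)], whose points are at
    distance less than 1 from [c]. *)
Lemma fits_fuse (a : Ord) (c u v : R) :
  fusible c -> c - 1 < u -> v <= c + 1 ->
  fits a u v -> fits a (fuse u c) (fuse v c).
Proof.
intros Hc Hu; revert v; induction a as [J f IH]; intros v Hv H i.
destruct (H i) as [w [Hw [Huw Hf]]].
exists (fuse w c); repeat split.
- apply fusible_fuse; trivial; apply Rabs_def1; lra.
- unfold fuse; lra.
- unfold fuse; lra.
- apply IH; trivial; lra.
Qed.

Lemma fusible_half (x : R) : fusible x -> fusible (x + 1/2).
Proof.
intro H; replace (x + 1/2) with (fuse x x) by (unfold fuse; lra).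
apply fusible_fuse; trivial; rewrite Rminus_diag, Rabs_R0; lra.
Qed.

Lemma fits_half (a : Ord) (u v : R) :
  fits a u v -> fits a (u + 1/2) (v + 1/2).
Proof.
revert v; induction a as [J f IH]; intros v H i.
destruct (H i) as [w [Hw [Huw Hf]]].
exists (w + 1/2); repeat split; try lra.
- now apply fusible_half.
- now apply IH.
Qed.

Lemma fusible_INR (n : nat) : fusible (INR n).
Proof.
induction n as [|n IH]; [exact fusible_zero |].
rewrite S_INR; replace (INR n + 1) with (INR n + 1/2 + 1/2) by lra.
now do 2 apply fusible_half.
Qed.

Definition clusters_below (a : Ord) (z : R) : Prop :=
  forall u, u < z -> fits a u z.

Lemma clusters_below_half (a : Ord) (z : R) :
  clusters_below a z -> clusters_below a (z + 1/2).
Proof.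
intros H u Hu; replace u with (u - 1/2 + 1/2) by lra.
apply fits_half, H; lra.
Qed.

Lemma clusters_below_fuse (a : Ord) (z c : R) :
  fusible c -> c - 1 < z < c + 1 -> clusters_below a z -> clusters_below a (fuse z c).
Proof.
intros Hc Hz H u Hu.
(* [2 * u - c - 1] is the preimage of [u] under fusing with [c]; the midpoint keeps [t] above
   [c - 1]. *)
set (t := Rmax (2 * u - c - 1) ((c - 1 + z) / 2)).
assert (H1 : 2 * u - c - 1 <= t) by apply Rmax_l.
assert (H2 : (c - 1 + z) / 2 <= t) by apply Rmax_r.
assert (H3 : t < z) by (apply Rmax_lub_lt; unfold fuse in Hu; lra).
apply (fits_weaken a (fuse t c) (fuse z c)); [unfold fuse; lra | lra |].
apply fits_fuse; trivial; try lra.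
now apply H.
Qed.

(** [Q] is abstract in order to serve both for [fusible] and for [clusters_below] of a power. *)
Lemma approach_succ (Q : R -> Prop) (x z u : R) :
  (forall y, Q y -> Q (y + 1/2)) ->
  (forall y, x - 1 < y < x + 1 -> Q y -> Q (fuse y x)) ->
  Q z -> z < x + 1 -> u < x + 1 ->
  exists y, u < y < x + 1 /\ Q y.
Proof.
intros Hhalf Hfuse Hz Hzx Hu.
assert (Hnear : exists y, x - 1 < y < x + 1 /\ Q y).
(* Each step of 1/2 lowers [2 * (x - z)] by 1; taken only from [z <= x - 1], it stays below
   [x + 1]. *)
{ destruct (INR_unbounded (2 * (x - z))) as [n Hn].
  revert z Hz Hzx Hn; induction n as [|n IH]; intros z Hz Hzx Hn.
  - simpl in Hn; exists z; split; trivial; lra.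
  - rewrite S_INR in Hn.
    destruct (Rlt_or_le (x - 1) z); [exists z; split; trivial; lra |].
    apply (IH (z + 1/2)); [now apply Hhalf | lra | lra]. }
assert (Hclose : forall n, exists y, x + 1 - 2 * (1/2) ^ n < y < x + 1 /\ Q y).
{ induction n as [|n [y [Hy HQ]]]; simpl.
  - destruct Hnear as [y [Hy HQ]]; exists y; split; trivial; lra.
  - exists (fuse y x); split; [unfold fuse; lra |].
    apply Hfuse; trivial.
    (* This gives [x - 1 < y], so that [y] may be fused with [x] again. *)
    assert (Hpow : (1/2) ^ n <= 1 ^ n) by (apply pow_incr; lra).
    rewrite pow1 in Hpow; lra. }
destruct (pow_lt_1_zero (1/2)) with (y := (x + 1 - u) / 2) as [N HN].
{ rewrite Rabs_pos_eq; lra. }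
{ lra. }
specialize (HN N (le_n N)); rewrite Rabs_pos_eq in HN by (apply pow_le; lra).
destruct (Hclose N) as [y [Hy HQ]].
exists y; split; trivial; lra.
Qed.

Lemma clusters_below_omega_pow (a : Ord) (x : R) :
  fusible x -> fits a 0 x -> clusters_below (omega_pow a) (x + 1).
Proof.
revert x; induction a as [J f IH]; intros x Hx H u Hu.
apply fits_omax.
- intros [].
  destruct (approach_succ fusible x x u) as [y [Hy HQ]]; trivial; try lra.
  + apply fusible_half.
  + intros y Hy HQ; apply fusible_fuse; trivial; apply Rabs_def1; lra.
  + exists y; repeat split; trivial; try lra; intros [].
- apply fits_osup; intro i.
  destruct (H i) as [w [Hw [H0w Hf]]].
  apply fits_omul_omega; trivial; intros t Ht.
  destruct (approach_succ (clusters_below (omega_pow (f i))) x (w + 1) t)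
    as [z [Hz HQ]]; trivial; try lra.
  + apply clusters_below_half.
  + intros y Hy; now apply clusters_below_fuse.
  + now apply IH.
  + exists z; split; trivial; now apply HQ.
Qed.

Lemma fits_omega : fits omega 0 1.
Proof.
apply fits_osup; intro n.
enough (exists w, fusible w /\ 0 <= w < 1 /\ fits (ofnat n) 0 w)
  as [w [_ [Hw H]]] by (apply (fits_weaken _ 0 w); trivial; lra).
induction n as [|n [w [Hw [H01 H]]]].
- exists 0; repeat split; [exact fusible_zero | lra | lra | intros []].
(* Since [fuse w 0] is [(w + 1) / 2], the witnesses are [1 - (1/2) ^ n]. *)
- exists (fuse w 0); repeat split; try (unfold fuse; lra).
  + apply fusible_fuse; trivial; [exact fusible_zero | apply Rabs_def1; lra].
  + intros []; exists w; repeat split; trivial; unfold fuse; lra.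
Qed.

Lemma fits_omega_tower (n : nat) : fits (omega_tower n) 0 (INR (S n)).
Proof.
induction n as [|n IH]; [exact fits_omega |].
rewrite S_INR; apply clusters_below_omega_pow; trivial.
- apply fusible_INR.
- pose proof (pos_INR (S n)); lra.
Qed.

Lemma rank_unfold (W : WellOrder) (x : carrier W) :
  rank W x =
  mk_ord {y : carrier W | wlt W y x} (fun y => rank W (proj1_sig y)).
Proof.
unfold rank at 1; rewrite Fix_eq; [reflexivity |].
intros y g h Hgh; f_equal.
apply functional_extensionality; intro z; apply Hgh.
Qed.

(** The witnesses inside [fits] are fusible numbers below [x], hence indices of the rank of [x]. *)
Lemma fits_rank (a : Ord) (x : Fusible) :
  fits a 0 (proj1_sig x) -> ole a (rank fusible_order x).
Proof.
revert x; induction a as [J f IH]; intros x H.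
rewrite rank_unfold; intro i.
destruct (H i) as [w [Hw [Hwx Hf]]].
exists (exist _ (exist _ w Hw : Fusible) (proj2 Hwx)).
now apply IH.
Qed.

Theorem mainTheorem4 : ole epsilon0 (order_type fusible_order).
Proof.
intros [n i].
destruct (fits_elt _ _ _ i (fits_omega_tower n)) as [w [Hw [_ H]]].
exists (exist _ w Hw).
now apply fits_rank.
Qed.
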